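(* For all $\varepsilon>0$ and $\delta>0$ there exists a constant $C$ such that if $p=p(n)\geq Cn^{-1/2}$, then $G(n,p)$ asymptotically almost surely satisfies the following: every Hamiltonian subgraph $G'$ of $G(n,p)$ with more than $(\frac{1}{2}+\varepsilon)\frac{n^2p}{2}$ edges contains a cycle of length $t$ for every integer $t\in[\delta n,(1-\delta)n]$.
   Context: $G(n,p)$ is the binomial random graph on vertex set $\{1,\dots,n\}$ in which each pair is an edge independently with probability $p$; a.a.s. means with probability tending to $1$ as $n\to\infty$. A graph is Hamiltonian if it contains a cycle through all its vertices. *)

(* Defs.v *)
From HB Require Import structures.
From mathcomp Require Import all_boot all_order all_algebra.
From mathcomp Require Import boolp classical_sets reals topology normedtype sequences.

Set Implicit Arguments.
Unset Strict Implicit.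
Unset Printing Implicit Defensive.

Import Order.TTheory GRing.Theory Num.Theory.
Import numFieldNormedType.Exports.

Local Open Scope ring_scope.

Definition pairs (V : finType) : {set {set V}} :=
  [set e : {set V} | #|e| == 2%N].

(* A simple graph on V is given by its edge set, an element of
   [powerset (pairs V)].  All graphs here have the whole of V as vertex set,
   so subgraphs are spanning. *)
Definition adj (V : finType) (G : {set {set V}}) : rel V :=
  fun x y => [set x; y] \in G.

(* The size condition excludes the degenerate closed walks with at most two
   vertices, which the library's [ucycle] allows. *)
Definition is_cycle (V : finType) (G : {set {set V}}) (c : seq V) : Prop :=
  (2 < size c)%N /\ ucycle (adj G) c.

Definition has_cycle (V : finType) (G : {set {set V}}) (t : nat) : Prop :=
  exists c : seq V, is_cycle G c /\ size c = t.

Definition hamiltonian (V : finType) (G : {set {set V}}) : Prop :=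
  exists c : seq V, is_cycle G c /\ forall v : V, v \in c.

Definition gnp_weight (R : realType) (n : nat) (p : R)
    (G : {set {set 'I_n}}) : R :=
  \prod_(e in pairs 'I_n) (if e \in G then p else 1 - p).

Definition gnp_pr (R : realType) (n : nat) (p : R)
    (Q : {set {set 'I_n}} -> Prop) : R :=
  \sum_(G in powerset (pairs 'I_n) | `[< Q G >]) gnp_weight p G.

Definition aas (R : realType) (p : nat -> R)
    (Q : forall n : nat, {set {set 'I_n}} -> Prop) : Prop :=
  ((fun n : nat => gnp_pr (p n) (@Q n)) @ \oo --> (1 : R))%classic.

(* Main.v *)
(* Fix an ordering of the vertices along a Hamilton cycle of [G'], and a target
   length [t].  Following Bondy, a chord from position [x] to [x + d] is paired,
   for each small shift [s], with a chord starting at [x + s] such that the two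
   chords together with two arcs of the Hamilton cycle form a cycle of length [t].
   For each [s] this pairing is a partial injection defined on almost all chords,
   so every set containing noticeably more than half of the chords spans on the
   order of [n^3] paired couples.  If [G'] has no [t]-cycle, its chords are
   independent for the pairing, hence (Kleitman-Winston) lie in a container of at
   most [(1 + eps) n^2 / 4] pairs determined by a fingerprint of [O(n)] chords.
   By a Chernoff bound, [G(n,p)] has at least [(1/2 + eps) n^2 p / 2] edges in
   a given container with probability at most [exp (- c n^2 p)], and
   [n^2 p >= C n^(3/2)] beats the [exp (O(n log n))] choices of the Hamilton
   cycle, [t] and the fingerprint. *)
Require Import Defs.
From HB Require Import structures.
From mathcomp Require Import all_boot all_order all_algebra.
From mathcomp Require Import boolp classical_sets reals topology normedtype sequences.
From mathcomp Require Import exp.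
(* [classical_sets] shadows [set0], [subsetP] and others. *)
From mathcomp Require Import fintype finset zify ring lra.

Set Implicit Arguments.
Unset Strict Implicit.
Unset Printing Implicit Defensive.

Import Order.TTheory GRing.Theory Num.Theory.
Import numFieldNormedType.Exports.

(** * Fingerprints and containers *)

Local Open Scope nat_scope.

(** [N v] acts as an out-neighbourhood, with no symmetry assumed. As the container avoids every
    [N u] with [u] in [T], its second condition leaves each member fewer than [D] out-neighbours
    inside the container. *)
Definition container (V : finType) (N : V -> {set V}) (D : nat) (T : {set V}) :=
  [set v in ~: \bigcup_(u in T) N u | #|N v :\: \bigcup_(u in T) N u| < D].

(* [T] is a largest subset of [I] whose elements each cost at least [D] vertices
   of the neighbourhood. *)
Lemma fingerprint (V : finType) (N : V -> {set V}) (D : nat) (I : {set V}) :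
  0 < D -> (forall u v, u \in I -> v \in I -> v \notin N u) ->
  exists T : {set V}, #|T| * D <= #|V| /\ I \subset container N D T.
Proof.
move=> D0 indI; pose NN (T : {set V}) := \bigcup_(u in T) N u.
pose P (T : {set V}) := (T \subset I) && (#|T| * D <= #|NN T|).
have P0 : P set0 by rewrite /P sub0set cards0.
case: (arg_maxnP (fun T : {set V} => #|T|) P0) => T /andP[TI TD] Tmax.
exists T; split; first exact: leq_trans TD (max_card _).
apply/subsetP => v vI; rewrite !inE; apply/andP; split.
  by apply/bigcupP => -[u uT]; apply/negP/indI => //; apply: (subsetP TI).
rewrite ltnNge; apply/negP => big.
have NNU : NN (v |: T) = NN T :|: N v by rewrite /NN bigcup_setU big_set1 setUC.
have cN : #|NN (v |: T)| = #|NN T| + #|N v :\: NN T|.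
  rewrite NNU -(cardsID (NN T) (NN T :|: N v)) setIC (setIidPl (subsetUl _ _)).
  by rewrite setDUl setDv set0U.
have vT : v \notin T.
  apply/negP => vT; move: big; rewrite (_ : N v :\: _ = set0); first by rewrite cards0 leqNgt D0.
  by apply/eqP; rewrite setD_eq0; apply: bigcup_sup.
have PT : P (v |: T).
  apply/andP; split; first by rewrite subUset sub1set vI.
  by rewrite cN cardsU1 vT mulnDl mul1n addnC leq_add.
by have := Tmax _ PT; rewrite cardsU1 vT; lia.
Qed.

(** Double count the pairs [(s, v)] with [v] and [phi s v] both in [C]. For each [s], at most [b]
    members of [C] lie outside the domain and, by injectivity, at most [#|V| - #|C|] are sent out of
    [C]; each [v] takes part in at most [D] pairs. *)
Lemma card_partial_injections (V J : finType) (dom : J -> pred V)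
    (phi : J -> V -> V) (b D : nat) (C : {set V}) :
  (forall s, {in dom s &, injective (phi s)}) ->
  (forall v, injective (phi^~ v)) ->
  (forall s, #|[set v | ~~ dom s v]| <= b) ->
  (forall v, v \in C ->
     #|[set phi s v | s in [set s | dom s v]] :&: C| <= D) ->
  #|J| * (2 * #|C|) <= #|J| * (#|V| + b) + D * #|C|.
Proof.
move=> inj1 inj2 hb hD.
pose A s := [set v in C | dom s v && (phi s v \in C)].
have step s : 2 * #|C| <= #|V| + b + #|A s|.
  pose B1 := [set v in C | ~~ dom s v].
  pose B2 := [set v in C | dom s v && (phi s v \notin C)].
  have CE : C \subset B1 :|: B2 :|: A s.
    apply/subsetP => v vC; rewrite !inE vC /=.
    by case: (dom s v) => //=; case: (phi s v \in C).
  have hB1 : #|B1| <= b.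
    apply: leq_trans (hb s); apply/subset_leq_card/subsetP => v.
    by rewrite !inE => /andP[].
  have hB2 : #|B2| + #|C| <= #|V|.
    rewrite -(cardsC C) addnC leq_add2l -(card_in_imset (f := phi s)).
      apply/subset_leq_card/subsetP => _ /imsetP[v + ->].
      by rewrite !inE => /and3P[].
    by move=> u v; rewrite !inE => /and3P[_ du _] /and3P[_ dv _]; exact: inj1.
  have := subset_leq_card CE; have := cardsU (B1 :|: B2) (A s).
  have := cardsU B1 B2; lia.
have sumA : \sum_s #|A s| <= D * #|C|.
  rewrite (eq_bigr (fun s => \sum_(v in C) (dom s v && (phi s v \in C) : nat))); last first.
    move=> s _; rewrite -sum1_card [RHS]big_mkcond [LHS]big_mkcond /=.
    by apply: eq_bigr => v _; rewrite inE; do 2!case: (_ \in C); case: (dom s v).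
  rewrite exchange_big /= mulnC -sum_nat_const; apply: leq_sum => v vC.
  apply: leq_trans (hD v vC).
  rewrite -big_mkcond /= sum1_card.
  rewrite -(card_imset _ (inj2 v)); apply/subset_leq_card/subsetP => u.
  case/imsetP => s; rewrite unfold_in => /andP[ds pC] ->.
  by rewrite inE pC andbT; apply: imset_f; rewrite inE.
have : \sum_(s : J) (2 * #|C|) <= \sum_(s : J) (#|V| + b + #|A s|).
  by apply: leq_sum => s _.
rewrite [X in _ <= X -> _]big_split !sum_nat_const => h; apply: leq_trans h _.
by rewrite leq_add2l.
Qed.

(** Padding with [None] lets tuples of one fixed length index all small fingerprints in the union
    bound. *)
Lemma tuple_of_small_set (V : finType) (q : nat) (T : {set V}) : #|T| <= q ->
  exists f : q.-tuple (option V), T = [set v | Some v \in f].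
Proof.
move=> hT.
have hs : size (map Some (enum T) ++ nseq (q - #|T|) None) == q.
  by rewrite size_cat size_map size_nseq -cardE subnKC.
exists (Tuple hs); apply/setP => v; rewrite inE /= mem_cat mem_nseq andbF orbF.
by rewrite mem_map ?mem_enum // => x y [].
Qed.

Lemma card_ordered_pairs (V : finType) (E : {set {set V}}) : E \subset pairs V ->
  #|[set u : V * V | [set u.1; u.2] \in E]| = 2 * #|E|.
Proof.
move=> EP; pose g (u : V * V) := [set u.1; u.2].
have -> : [set u : V * V | [set u.1; u.2] \in E] = g @^-1: E by apply/setP => u; rewrite !inE.
rewrite -sum1_card (partition_big g (mem E)) /=; last by move=> u; rewrite inE.
rewrite mulnC -sum_nat_const; apply: eq_bigr => e eE.
have : #|e| == 2 by have := subsetP EP e eE; rewrite /pairs inE.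
case/cards2P => a [b [ab eab]].
have -> : 2 = #|[set (a, b); (b, a)]| by rewrite cards2 xpair_eqE (eq_sym b) andbb ab.
rewrite -[RHS]sum1_card; apply: eq_bigl => -[x y]; rewrite !inE /g /= !xpair_eqE.
apply/idP/idP => [/andP[_ /eqP xy]|].
  have: x \in [set a; b] by rewrite -eab -xy !inE eqxx.
  have: y \in [set a; b] by rewrite -eab -xy !inE eqxx orbT.
  have: a \in [set x; y] by rewrite xy eab !inE eqxx.
  have: b \in [set x; y] by rewrite xy eab !inE eqxx orbT.
  rewrite !inE; move: ab; rewrite !(eq_sym a) !(eq_sym b).
  by case: (x =P a) (y =P a) (x =P b) (y =P b) => [?|?] [?|?] [?|?] [?|?]; subst;
    rewrite ?eqxx //=; auto.
by case/orP => /andP[/eqP-> /eqP->]; rewrite ?(setUC [set b]) -eab eqxx eE.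
Qed.

(** * Cycles made of two chords and two arcs *)

Section Arcs.
Variables (V : finType) (G : {set {set V}}) (n : nat) (w : nat -> V).
Hypothesis w_adj : forall k, adj G (w k) (w k.+1).
Hypothesis w_n : w n = w 0.
Hypothesis w_inj : forall i j, i < n -> j < n -> w i = w j -> i = j.

Lemma adj_sym : symmetric (adj G).
Proof. by move=> x y; rewrite /adj setUC. Qed.

Lemma path_iota a k : path (relpre w (adj G)) a (iota a.+1 k).
Proof. by elim: k a => //= k IH a; rewrite w_adj IH. Qed.

Lemma last_iota a k : last a (iota a.+1 k) = a + k.
Proof. by elim: k a => [|k IH] a /=; rewrite ?addn0 // IH addSnnS. Qed.

Lemma has_cycle_of_indices (c : seq nat) : 2 < size c -> uniq c ->
  all (fun k => k < n) c -> cycle (relpre w (adj G)) c -> has_cycle G (size c).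
Proof.
move=> sc uc cn cc; exists (map w c); rewrite /is_cycle size_map; split; last by [].
split; first by [].
apply/andP; split; last first.
  rewrite map_inj_in_uniq // => i j ic jc; apply: w_inj.
    exact: (allP cn). exact: (allP cn).
case: c {sc uc cn} cc => //= x c; rewrite rcons_path => cc.
rewrite rcons_path path_map last_map; exact: cc.
Qed.

(** The cycle is [0, ..., s, e, ..., d], closed by the chord from [d] to [0]. *)
Lemma parallel_chords s e d : s < e -> e <= d -> d < n -> 0 < s ->
  adj G (w 0) (w d) -> adj G (w s) (w e) -> has_cycle G (s + d - e + 2).
Proof.
move=> se ed dn s0 h1 h2.
have <- : size (iota 0 s.+1 ++ iota e (d - e).+1) = s + d - e + 2.
  by rewrite size_cat !size_iota; lia.
apply: has_cycle_of_indices.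
- by rewrite size_cat !size_iota; lia.
- rewrite cat_uniq !iota_uniq andbT; apply/andP; split=> //.
  apply/hasPn => x; rewrite !mem_iota; lia.
- apply/allP => x; rewrite mem_cat !mem_iota; lia.
- rewrite /= rcons_cat /= cat_path path_iota last_iota add0n /= h2.
  rewrite rcons_path path_iota last_iota /=.
  by rewrite subnKC // adj_sym.
Qed.

(** The cycle is [0, d, d-1, ..., s, e, ..., n-1], closed by the edge from [n-1] to [w n = w 0]; the
    arc between [s] and [d] is run backwards. *)
Lemma crossing_chords s e d : s < d -> d < e -> e < n -> 0 < s ->
  adj G (w 0) (w d) -> adj G (w s) (w e) -> has_cycle G (n + d - s - e + 2).
Proof.
move=> sd de en s0 h1 h2.
have <- : size (0 :: rev (iota s (d - s).+1) ++ iota e (n - e)) = n + d - s - e + 2.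
  by rewrite -cat1s !size_cat size_rev !size_iota /=; lia.
apply: has_cycle_of_indices.
- by rewrite -cat1s !size_cat size_rev !size_iota /=; lia.
- rewrite cons_uniq mem_cat mem_rev !mem_iota cat_uniq rev_uniq !iota_uniq andbT.
  apply/andP; split; first by lia.
  apply/hasPn => x; rewrite mem_rev !mem_iota; lia.
- apply/allP => x; rewrite inE mem_cat mem_rev !mem_iota; lia.
have -> : n - e = (n.-1 - e).+1 by lia.
have hd : iota s (d - s).+1 = rcons (iota s (d - s)) d.
  by rewrite -addn1 iotaD /= subnKC ?cats1 // ltnW.
rewrite [X in rev X]hd rev_rcons cat_cons /= rcons_cat /= cat_path /= h1.
rewrite rcons_path path_iota last_iota.
have hr : rev (iota s (d - s)) = rcons (rev (iota s.+1 (d - s).-1)) s.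
  by rewrite -{1}(@prednK (d - s)) ?subn_gt0 //= rev_cons.
apply/and5P; split=> //; first last.
- by rewrite /= -w_n; have := w_adj n.-1; rewrite prednK ?subnKC //; lia.
- by rewrite hr last_rcons.
have := path_iota s (d - s).
have E : iota s.+1 (d-s) = rcons (iota s.+1 (d - s).-1) d.
  have -> : d - s = (d-s).-1 + 1 by lia.
  by rewrite iotaD /= cats1 ?addn1 /=; congr rcons; lia.
rewrite (eq_path (e' := fun x y => relpre w (adj G) y x)); last by move=> x y; rewrite /= adj_sym.
rewrite -rev_path last_iota subnKC ?(ltnW sd) //.
rewrite (_ : belast s (iota s.+1 (d - s)) = iota s (d - s)) // E belast_rcons.
by rewrite -[LHS]/(iota s (d - s).-1.+1) prednK // subn_gt0.
Qed.
End Arcs.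

(** * Shifting chords of a Hamilton cycle *)

Lemma add_ord_proof n (i : 'I_n) k : (i + k) %% n < n.
Proof. by rewrite ltn_pmod // (leq_ltn_trans _ (ltn_ord i)). Qed.

Definition add_ord n (i : 'I_n) k : 'I_n := Ordinal (add_ord_proof i k).

Lemma add_ord_injr n (i : 'I_n) a b : a < n -> b < n ->
  add_ord i a = add_ord i b -> a = b.
Proof.
by move=> an bn /(congr1 val) /= /eqP; rewrite eqn_modDl !modn_small // => /eqP.
Qed.

Lemma add_ordA n (i : 'I_n) a b : add_ord (add_ord i a) b = add_ord i (a + b).
Proof. by apply: val_inj; rewrite /= modnDml addnA. Qed.

Lemma add_ord_surj n (i j : 'I_n) : exists d : 'I_n, add_ord i d = j.
Proof.
exists (add_ord j (n - i)); apply: val_inj => /=.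
by rewrite modnDmr addnCA subnKC ?(ltnW (ltn_ord i)) // modnDr modn_small.
Qed.

(* The chord joining positions [x] and [x + d] (mod [n]) is encoded as the pair
   [(x, d)].  The shifted chord is parallel to the original one, with
   [d' = d - (t - 2)], when [d > t - 2 + s], and crosses it when
   [2 s < d < t - 2 + s]; the images of the two ranges of [d] are disjoint. *)
Definition shift_ok (t s d : nat) : bool :=
  (t - 2 + s < d) || (2 * s < d) && (d < t - 2 + s).

Definition shift_offset (n t s d : nat) : nat :=
  if t - 2 + s < d then d - (t - 2) else d + (n - t + 2) - 2 * s.

Definition shift_chord n (t s : nat) (v : 'I_n * 'I_n) : 'I_n * 'I_n :=
  (add_ord v.1 s, insubd v.2 (shift_offset n t s v.2)).

Definition shifts n (t m : nat) (v : 'I_n * 'I_n) : {set 'I_n * 'I_n} :=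
  [set shift_chord t s.+1 v | s : 'I_m in [set s : 'I_m | shift_ok t s.+1 v.2]].

Definition chord (V : finType) n (c : n.-tuple V) (v : 'I_n * 'I_n) : {set V} :=
  [set tnth c v.1; tnth c (add_ord v.1 v.2)].

Lemma shift_offset_lt n t s d : 0 < s -> 1 < t <= n -> d < n -> shift_ok t s d ->
  shift_offset n t s d < n.
Proof. rewrite /shift_ok /shift_offset => s0 /andP[t2 tn] dn; case: ifP => /=; lia. Qed.

(** Each branch is a translation; parallel offsets are at most [n - t + 1], crossing ones exceed
    [n - t + 2]. *)
Lemma shift_offset_inj n t s d d' : 1 < t <= n -> d < n -> d' < n ->
  shift_ok t s d -> shift_ok t s d' ->
  shift_offset n t s d = shift_offset n t s d' -> d = d'.
Proof.
rewrite /shift_ok /shift_offset => /andP[t2 tn] dn dn'.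
case: ifP => /=; case: ifP => /=; lia.
Qed.

Lemma shift_chord_inj n t s : 0 < s -> 1 < t <= n ->
  {in (fun v : 'I_n * 'I_n => shift_ok t s v.2) &, injective (shift_chord t s)}.
Proof.
move=> s0 tn [x d] [x' d']; rewrite /in_mem /= => okd okd' [/eqP].
rewrite eqn_modDr !modn_small // => /eqP/val_inj <- /(congr1 val).
rewrite !val_insubd !shift_offset_lt // => h; congr pair; apply: val_inj.
exact: shift_offset_inj okd okd' h.
Qed.

Lemma card_not_shift_ok n t m s : s <= m ->
  #|[set v : 'I_n * 'I_n | ~~ shift_ok t s v.2]| <= n * (2 * m + 2).
Proof.
move=> sm; pose B := [set d : 'I_n | ~~ shift_ok t s d].
have -> : [set v : 'I_n * 'I_n | ~~ shift_ok t s v.2] = setX [set: 'I_n] B.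
  by apply/setP => v; rewrite !inE.
rewrite cardsX cardsT card_ord leq_mul2l; apply/orP; right.
(* Only [d <= 2 * s] and [d = t - 2 + s] fail; the latter, if above [2 * m], goes to the extra value
   [2 * m + 1]. *)
pose f (d : 'I_n) : 'I_(2 * m).+2 := inord (if d <= 2 * m then d : nat else (2 * m).+1).
rewrite -(card_in_imset (f := f)); first by rewrite (leq_trans (max_card _)) // card_ord addn2.
move=> d d'; rewrite !inE /shift_ok => hd hd' /(congr1 val) /=.
rewrite /f !inordK; try by case: ifP; lia.
move=> h; apply: val_inj; move: h hd hd' => /=; do 2!case: ifP => /=; lia.
Qed.

Lemma card_shift_container n t m D (T : {set 'I_n * 'I_n}) : 1 < t <= n -> m < n ->
  m * (2 * #|container (@shifts n t m) D T|) <=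
  m * (n * n + n * (2 * m + 2)) + D * #|container (@shifts n t m) D T|.
Proof.
move=> tn mn; have := @card_partial_injections _ 'I_m
  (fun s => [pred v : 'I_n * 'I_n | shift_ok t s.+1 v.2])
  (fun s v => shift_chord t s.+1 v) (n * (2 * m + 2)) D (container (@shifts n t m) D T).
rewrite card_prod !card_ord; apply.
- by move=> s; apply: shift_chord_inj.
- move=> v s s' [] /eqP; rewrite eqn_modDl !modn_small => [/eqP[]/val_inj//||];
    exact: leq_ltn_trans (ltn_ord _) mn.
- by move=> s; apply: card_not_shift_ok.
- move=> v; rewrite inE => /andP[_ /ltnW]; apply: leq_trans.
  apply/subset_leq_card/subsetP => u; rewrite inE => /andP[uN].
  by rewrite !inE => /andP[-> _].
Qed.

(** Take [x] as origin. The offset is the one for which the cycle length comes out as [t]. The bound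
    [m + 2 <= t] gives [e <= d] for parallel chords, and [t + m <= n] gives [d < e] for crossing
    ones. *)
Lemma has_cycle_of_shift (V : finType) (G : {set {set V}}) n (c : n.-tuple V) t m s
    (v : 'I_n * 'I_n) :
  injective (tnth c) -> (forall i, adj G (tnth c i) (tnth c (add_ord i 1))) ->
  m + 2 <= t -> t + m <= n -> 0 < s <= m -> shift_ok t s v.2 ->
  chord c v \in G -> chord c (shift_chord t s v) \in G -> has_cycle G t.
Proof.
case: v => x d cinj cadj mt tn /andP[s0 sm] ok.
have tn' : 1 < t <= n by lia.
rewrite /chord /= val_insubd shift_offset_lt // add_ordA.
pose w k := tnth c (add_ord x k).
have w0 : w 0 = tnth c x.
  by congr tnth; apply: val_inj; rewrite /= addn0 modn_small.
rewrite -w0 -/(w d) -/(w s) -/(w _) -/(adj G _ _) -/(adj G _ _).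
have w_adj k : adj G (w k) (w k.+1) by rewrite /w -(addn1 k) -add_ordA.
have w_n : w n = w 0.
  by congr tnth; apply: val_inj; rewrite /= modnDr addn0.
have w_inj i j : i < n -> j < n -> w i = w j -> i = j.
  by move=> ? ? /cinj; apply: add_ord_injr.
have dn := ltn_ord d.
move: ok; rewrite /shift_ok /shift_offset /=.
case: ifP => h1 /= ok h h'.
  have -> : t = s + d - (s + (d - (t - 2))) + 2 by lia.
  by apply: (parallel_chords w_adj w_inj) h h'; lia.
have -> : t = n + d - s - (s + (d + (n - t + 2) - 2 * s)) + 2 by lia.
by apply: (crossing_chords w_adj w_n w_inj) h h'; lia.
Qed.

(** * Containers for Hamiltonian graphs without a [t]-cycle *)

Lemma hamiltonian_tuple n (G : {set {set 'I_n}}) : hamiltonian G ->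
  exists c : n.-tuple 'I_n, injective (tnth c) /\
    forall i, adj G (tnth c i) (tnth c (add_ord i 1)).
Proof.
case=> c [[_ /andP[cyc uc]] allc].
(* At the last index the right-hand [nth] runs off the tail and returns its default [z], the head:
   this is the wrap-around. *)
have nthS (s : seq 'I_n) (y : 'I_n) k : k < size s ->
    nth y s (k.+1 %% size s) = if s is z :: s' then nth z s' k else y.
  case: s => //= z s; rewrite ltnS leq_eqVlt => /predU1P[->|ks].
    by rewrite modnn /= nth_default.
  by rewrite modn_small //=; apply: set_nth_default.
have sc : size c == n.
  by rewrite -(card_uniqP uc) -[X in _ == X]card_ord; apply/eqP/eq_card => v; rewrite allc.
exists (Tuple sc); split=> [|i]; first by apply/(@tuple_uniqP n _ (Tuple sc)).
set x := tnth _ i.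
have ic : i < size c by rewrite (eqP sc).
have xE : x = nth x c i by apply: (tnth_nth x).
have ix : index x c = i by rewrite {1}xE index_uniq.
have -> : tnth (Tuple sc) (add_ord i 1) = next c x; last by rewrite next_cycle.
rewrite next_nth allc ix (tnth_nth x) /= -nthS //.
by congr nth; rewrite (eqP sc) addn1.
Qed.

(** A pair of vertices is encoded once from each endpoint; requiring both encodings to lie in the
    container yields the factor 2 in [card_chord_container]. *)
Definition chord_container n (c : n.-tuple 'I_n) (t m D : nat)
    (T : {set 'I_n * 'I_n}) : {set {set 'I_n}} :=
  [set e in pairs 'I_n |
    [forall v, (chord c v == e) ==> (v \in container (@shifts n t m) D T)]].

Lemma card_chord_container n (c : n.-tuple 'I_n) t m D T : injective (tnth c) ->
  2 * #|chord_container c t m D T| <= #|container (@shifts n t m) D T|.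
Proof.
move=> cinj; rewrite -card_ordered_pairs; last by apply/subsetP => e; rewrite inE => /andP[].
pose h (v : 'I_n * 'I_n) := (tnth c v.1, tnth c (add_ord v.1 v.2)).
apply: leq_trans (leq_imset_card h _); apply/subset_leq_card/subsetP => -[a b].
have [ci cK Kc] := injF_bij cinj.
have [d hd] := add_ord_surj (ci a) (ci b).
have hE : (a, b) = h (ci a, d) by rewrite /h /= hd !Kc.
rewrite !inE /= => /andP[_ /forallP /(_ (ci a, d))].
rewrite /chord /= hd !Kc eqxx /= => hv; rewrite hE; exact: imset_f.
Qed.

Lemma hamiltonian_no_cycle_container n (G : {set {set 'I_n}}) t m D :
  G \subset pairs 'I_n -> hamiltonian G -> ~ has_cycle G t ->
  m + 2 <= t -> t + m <= n -> 0 < D ->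
  exists (c : n.-tuple 'I_n) (T : {set 'I_n * 'I_n}),
    [/\ injective (tnth c), #|T| * D <= n * n & G \subset chord_container c t m D T].
Proof.
move=> GP /hamiltonian_tuple[c [cinj cadj]] noG mt tn D0.
pose I := [set v | chord c v \in G].
have [u v uI vI|T [hT IT]] := @fingerprint _ (@shifts n t m) D I D0.
  apply/imsetP => -[s]; rewrite inE => ok vE; apply: noG.
  move: uI vI; rewrite !inE vE => uI vI.
  by apply: (has_cycle_of_shift cinj cadj mt tn _ ok uI vI); exact: ltn_ord.
exists c, T; rewrite card_prod !card_ord in hT; split=> //.
apply/subsetP => e eG; rewrite inE (subsetP GP) //=.
apply/forallP => v; apply/implyP => /eqP ve; apply: (subsetP IT).
by rewrite inE ve.
Qed.

(** The excess 5 is 2 + 1 + 2: from [2 * m * K <= 2 * n], from [2 * K <= n], and from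
    [D * K <= 2 * m]. So the container has density at most [(1 + 5 / K) / 2] among the [n ^ 2]
    encodings. *)
Lemma card_shift_container_le n t K (T : {set 'I_n * 'I_n}) :
  let m := n %/ K in let D := (m %/ K).+1 in
  1 < K -> 2 * K ^ 2 <= n -> 1 < t <= n ->
  K * (2 * #|container (@shifts n t m) D T|) <= (K + 5) * n ^ 2.
Proof.
move=> m D K2 nK tn.
have mK : m * K <= n by exact: leq_divM.
have Km : K <= m by rewrite leq_divRL ?(ltnW K2) //; move: nK; rewrite expnS expn1; lia.
have mn : m < n by nia.
have := card_shift_container D T tn mn.
have := max_card (container (@shifts n t m) D T); rewrite card_prod !card_ord.
set c := #|_| => cn hc.
have DK : D * K <= 2 * m by have := leq_divM m K; rewrite /D; lia.
have m0 : 0 < m by lia.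
rewrite -(leq_pmul2l m0).
have h1 : m * (K * (2 * c)) <= K * (m * (n * n + n * (2 * m + 2)) + D * c).
  by rewrite mulnCA leq_mul2l hc orbT.
apply: leq_trans h1 _.
have h2 : K * (D * c) <= m * (2 * (n * n)).
  by rewrite mulnA (mulnC K) mulnA (mulnC m 2) leq_mul.
have h3 : n * (2 * (m * K)) <= n * (2 * n) by rewrite !leq_mul.
have h4 : n * (2 * K) <= n * n by rewrite leq_mul //; nia.
rewrite mulnDr.
apply: leq_trans (leq_add (leqnn _) h2) _.
rewrite mulnCA -mulnDr leq_mul2l; apply/orP; right.
rewrite expnS expn1; nia.
Qed.

Lemma fingerprint_size_le n K x : 1 < K -> 0 < n ->
  x * (n %/ K %/ K).+1 <= n * n -> x <= K ^ 2 * n.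
Proof.
move=> K2 n0 h; rewrite -(leq_pmul2r n0).
have h1 : n < (n %/ K).+1 * K by rewrite ltn_ceil // ltnW.
have h2 : n %/ K < (n %/ K %/ K).+1 * K by rewrite ltn_ceil // ltnW.
have h3 : n <= (n %/ K %/ K).+1 * K ^ 2.
  by rewrite (leq_trans (ltnW h1)) // expnS expn1 mulnA leq_mul2r h2 orbT.
rewrite (leq_trans (_ : _ <= x * ((n %/ K %/ K).+1 * K ^ 2))) ?leq_mul2l ?h3 ?orbT //.
by rewrite mulnA mulnC -mulnA leq_mul2l h orbT.
Qed.

Lemma card_fingerprints_le n K : 1 < n ->
  #|{: (n.-tuple 'I_n * 'I_n) * (K ^ 2 * n).-tuple (option ('I_n * 'I_n))}| <=
  n ^ ((3 * K ^ 2 + 2) * n).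
Proof.
move=> n2; rewrite !card_prod !card_tuple card_option card_prod !card_ord.
(* The successor counts [None], and [n ^ 2 + 1 <= n ^ 3] for [n >= 2]. *)
have h : (n * n).+1 ^ (K ^ 2 * n) <= n ^ (3 * (K ^ 2 * n)).
  by rewrite [n ^ (3 * _)]expnM; case: (K ^ 2 * n) => // q; rewrite leq_exp2r // !expnS expn0; nia.
apply: leq_trans (leq_mul (leqnn _) h) _.
by rewrite -expnSr -expnD leq_exp2l //; lia.
Qed.

(** * Tail bounds in G(n,p) *)

Local Open Scope ring_scope.

Lemma gnp_weight_ge0 (R : realType) (n : nat) (p : R) (G : {set {set 'I_n}}) :
  0 <= p <= 1 -> 0 <= gnp_weight p G.
Proof.
by move=> /andP[p0 p1]; apply: prodr_ge0 => e _; case: ifP; rewrite ?subr_ge0.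
Qed.

Lemma gnp_mgf (R : realType) (n : nat) (p a : R) (S : {set {set 'I_n}}) :
  S \subset pairs 'I_n ->
  \sum_(G in powerset (pairs 'I_n)) gnp_weight p G * a ^+ #|G :&: S| =
  (1 + p * (a - 1)) ^+ #|S|.
Proof.
move=> SP; pose P := pairs 'I_n.
(* Outside [P] the values 0 and 1 make every set containing a non-pair contribute nothing when the
   product is expanded. *)
pose f e := if e \in P then p * (if e \in S then a else 1) else 0.
pose g e := if e \in P then 1 - p else 1 : R.
transitivity (\prod_(e : {set 'I_n}) (f e + g e)).
  rewrite bigA_distr big_mkcond /=; apply: eq_bigr => G _.
  rewrite powersetE; case: ifPn => [GP|/subsetPn[e eG eP]]; last first.
    by rewrite (bigD1 e) //= eG /f (negbTE eP) mul0r.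
  rewrite /gnp_weight -prodr_const [X in X * _]big_mkcond [X in _ * X]big_mkcond -big_split /=.
  apply: eq_bigr => e _; rewrite in_setI /f /g -/P.
  have := subsetP GP e; case: (boolP (e \in G)) => eG; last by rewrite /= mulr1.
  by move=> ->.
rewrite -prodr_const [RHS]big_mkcond /=; apply: eq_bigr => e _; rewrite /f /g -/P.
by have := subsetP SP e; rewrite -/P; case: (e \in S) => [->//|_]; [ring|case: ifP => _; ring].
Qed.

Lemma gnp_total (R : realType) (n : nat) (p : R) :
  \sum_(G in powerset (pairs 'I_n)) gnp_weight p G = 1.
Proof.
have := gnp_mgf p 1 (sub0set (pairs 'I_n)); rewrite cards0 expr0 => <-.
by apply: eq_bigr => G _; rewrite setI0 cards0 expr0 mulr1.
Qed.

Lemma gnp_pr_le1 (R : realType) (n : nat) (p : R) (Q : {set {set 'I_n}} -> Prop) :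
  0 <= p <= 1 -> gnp_pr p Q <= 1.
Proof.
move=> hp; rewrite -(gnp_total n p) /gnp_pr big_mkcondr /=; apply: ler_sum => G _.
by case: ifP => // _; apply: gnp_weight_ge0.
Qed.

Lemma gnp_pr_le (R : realType) (n : nat) (p : R) (Q Q' : {set {set 'I_n}} -> Prop) :
  0 <= p <= 1 -> (forall G, Q G -> Q' G) -> gnp_pr p Q <= gnp_pr p Q'.
Proof.
move=> hp QQ'; rewrite /gnp_pr !big_mkcondr /=; apply: ler_sum => G _.
case: asboolP => [/QQ'/asboolT ->//|_]; case: ifP => // _.
exact: gnp_weight_ge0.
Qed.

Lemma gnp_union_bound (R : realType) (n : nat) (p B : R) (J : finType)
    (Q : {set {set 'I_n}} -> Prop) (bad : J -> {set {set 'I_n}} -> Prop) :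
  0 <= p <= 1 ->
  (forall j, gnp_pr p (bad j) <= B) ->
  (forall G : {set {set 'I_n}}, G \subset pairs 'I_n -> ~ Q G -> exists j, bad j G) ->
  1 - #|J|%:R * B <= gnp_pr p Q.
Proof.
move=> hp hB hbad; rewrite -[X in X - _](gnp_total n p) lerBlDr.
apply: (@le_trans _ _ (gnp_pr p Q + \sum_j gnp_pr p (bad j))); last first.
  have -> : #|J|%:R * B = \sum_(j : J) B by rewrite sumr_const mulr_natl.
  by rewrite lerD2l; apply: ler_sum => j _.
rewrite /gnp_pr [X in _ <= X + _]big_mkcondr /=.
under [X in _ <= _ + X]eq_bigr do rewrite big_mkcondr /=.
rewrite exchange_big -big_split /=; apply: ler_sum => G.
rewrite powersetE => GP; have w0 := gnp_weight_ge0 G hp.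
have sum0 : forall K : pred J, 0 <= \sum_(j | K j) (if `[< bad j G >] then gnp_weight p G else 0).
  by move=> K; apply: sumr_ge0 => j _; case: ifP.
case: asboolP => [_|/(hbad _ GP) [j bj]]; first by rewrite lerDl sum0.
rewrite add0r (bigD1 j) //= (asboolT bj) lerDl; exact: sum0.
Qed.

(** Chernoff's method: Markov's inequality for [expR (u * #|G :&: S|)], whose mean is given by
    [gnp_mgf], followed by [1 + x <= expR x]. *)
Lemma gnp_upper_tail (R : realType) (n : nat) (p u theta : R) (S : {set {set 'I_n}}) :
  0 <= p <= 1 -> 0 <= u < 1 -> S \subset pairs 'I_n ->
  gnp_pr p (fun G => theta < #|G :&: S|%:R) <=
  expR (p * (u / (1 - u)) * #|S|%:R - u * theta).
Proof.
move=> hp /andP[u0 u1] SP; have /andP[p0 p1] := hp.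
(* [exp (- u) >= 1 - u] *)
have hu : expR u - 1 <= u / (1 - u).
  have h := expR_ge1Dx (- u); rewrite expRN in h.
  have e0 := expR_gt0 u; have v0 : 0 < 1 - u by lra.
  rewrite ler_pdivlMr //.
  have : (1 - u) * expR u <= 1 by rewrite -ler_pdivlMr // div1r.
  nra.
have e1 : 1 <= expR u by rewrite -expR0 ler_expR.
apply: (@le_trans _ _ (expR (- (u * theta)) * (1 + p * (expR u - 1)) ^+ #|S|)); last first.
  rewrite [_ - u * theta]addrC expRD ler_wpM2l ?expR_ge0 // [p * _ * _]mulrC expRM_natl.
  apply: lerXn2r; rewrite ?nnegrE ?expR_ge0 //; first by nra.
  apply: le_trans (expR_ge1Dx _); rewrite lerD2l ler_wpM2l //.
rewrite -(gnp_mgf _ _ SP) mulr_sumr /gnp_pr big_mkcondr /=.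
apply: ler_sum => G _; have w0 := gnp_weight_ge0 G hp.
case: asboolP => [h|_]; last by rewrite !mulr_ge0 ?expR_ge0 // exprn_ge0 // expR_ge0.
rewrite -expRM_natl mulrCA -expRD ler_peMr // -[X in X <= _]expR0 ler_expR.
by rewrite addrC subr_ge0 mulrC ler_wpM2r // ltW.
Qed.

Lemma gnp_chord_container_tail (R : realType) (n : nat) (p eps : R) (S : {set {set 'I_n}}) :
  0 <= p <= 1 -> 0 < eps -> S \subset pairs 'I_n ->
  #|S|%:R <= (1 + eps) / 4 * n%:R ^+ 2 ->
  gnp_pr p (fun G => (2^-1 + eps) * (n%:R ^+ 2 * p / 2) < #|G :&: S|%:R) <=
  expR (- (eps ^+ 2 / (8 * (2 + 3 * eps)) * (n%:R ^+ 2 * p))).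
Proof.
move=> hp e0 SP hS; have /andP[p0 p1] := hp.
(* Chosen so that [(1 + eps) / 4 = (1 - u) (1 / 4 + 3 eps / 8)]. *)
pose u := eps / (2 + 3 * eps).
have d0 : 0 < 2 + 3 * eps by lra.
have hu : 0 <= u < 1.
  by rewrite /u divr_ge0 ?ltW //= ltr_pdivrMr // mul1r; lra.
apply: le_trans (gnp_upper_tail _ hp hu SP) _.
rewrite ler_expR.
have uE : u / (1 - u) = eps / (2 + 2 * eps).
  by rewrite /u; field; rewrite ?lt0r_neq0 //; lra.
have v0 : 0 <= p * (u / (1 - u)).
  by rewrite uE mulr_ge0 // divr_ge0 //; lra.
(* The first term equals [u (1/4 + 3 eps/8) n^2 p], whose coefficient is halfway between
   [1/4 + eps/4] for the container and [1/4 + eps/2] for the threshold; the difference is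
   [- u eps n^2 p / 8]. *)
apply: (@le_trans _ _ (p * (u / (1 - u)) * ((1 + eps) / 4 * n%:R ^+ 2) -
   u * ((2^-1 + eps) * (n%:R ^+ 2 * p / 2)))).
  by rewrite lerD2r ler_wpM2l.
rewrite le_eqVlt; apply/orP; left; apply/eqP; rewrite uE /u.
by field; apply/andP; split; apply: lt0r_neq0; lra.
Qed.

(** * Union bound and choice of constants *)

Lemma gnp_cycles_ge (R : realType) (n K : nat) (p eps delta : R) :
  0 <= p <= 1 -> 0 < eps -> (1 < K)%N -> (2 * K ^ 2 <= n)%N ->
  5 <= eps * K%:R -> 2 <= delta * K%:R ->
  1 - (n ^ ((3 * K ^ 2 + 2) * n))%:R *
      expR (- (eps ^+ 2 / (8 * (2 + 3 * eps)) * (n%:R ^+ 2 * p))) <=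
  gnp_pr p (fun G : {set {set 'I_n}} =>
    forall G' : {set {set 'I_n}}, G' \subset G -> hamiltonian G' ->
      (2^-1 + eps) * (n%:R ^+ 2 * p / 2) < #|G'|%:R ->
      forall t : nat, delta * n%:R <= t%:R <= (1 - delta) * n%:R -> has_cycle G' t).
Proof.
move=> hp e0 K2 nK epsK deltaK.
set B := expR _.
pose m := (n %/ K)%N; pose D := (m %/ K).+1.
pose J : finType := ((n.-tuple 'I_n * 'I_n) * (K ^ 2 * n).-tuple (option ('I_n * 'I_n)))%type.
pose S (j : J) := chord_container j.1.1 j.1.2 m D [set v | Some v \in j.2].
(* An arbitrary index, such as a non-injective tuple, may give a large container. Putting the size
   bound into the event makes its probability 0 in that case. *)
pose bad (j : J) (G : {set {set 'I_n}}) :=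
  #|S j|%:R <= (1 + eps) / 4 * n%:R ^+ 2 :> R /\
  (2^-1 + eps) * (n%:R ^+ 2 * p / 2) < #|G :&: S j|%:R.
have SP j : S j \subset pairs 'I_n by apply/subsetP => e; rewrite inE => /andP[].
have n2 : (1 < n)%N by nia.
apply: (@le_trans _ _ (1 - #|J|%:R * B)).
  by rewrite lerD2l lerN2 ler_wpM2r ?expR_ge0 // ler_nat card_fingerprints_le.
apply: (gnp_union_bound (bad := bad) hp) => [j|G GP].
  have [hS|hS] := pselect (#|S j|%:R <= (1 + eps) / 4 * n%:R ^+ 2 :> R); last first.
    rewrite /gnp_pr big1 ?expR_ge0 // => G /andP[_ /asboolP[]].
    by move=> h; case: (hS h).
  apply: le_trans (gnp_chord_container_tail hp e0 (SP j) hS).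
  by apply: gnp_pr_le => // G [].
move=> /existsNP[G' /not_implyP[G'G /not_implyP[ham /not_implyP[big]]]].
move=> /existsNP[t /not_implyP[/andP[t1 t2] noc]].
have mK : m%:R * K%:R <= n%:R :> R by rewrite -natrM ler_nat leq_divM.
have nKR : 2 * K%:R * K%:R <= n%:R :> R by rewrite -!natrM ler_nat -mulnA.
have K0 : 0 < K%:R :> R by rewrite ltr0n ltnW.
have n0 : 0 < n%:R :> R by rewrite ltr0n ltnW.
(* Both [m] and [2] are at most [n / K], and [2 / K <= delta]. *)
have hmd : (m + 2)%:R <= delta * n%:R :> R.
  have K1 : 1 <= K%:R :> R by rewrite ler1n ltnW.
  have h1 : 2 * K%:R <= n%:R :> R by apply: le_trans nKR; rewrite ler_peMr //; nra.
  have h2 : 2 * n%:R <= delta * K%:R * n%:R by rewrite ler_wpM2r // ltW.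
  rewrite natrD -(ler_pM2r K0) mulrDl -mulrA [n%:R * _]mulrC mulrA.
  lra.
have mt : (m + 2 <= t)%N by rewrite -(ler_nat R) (le_trans hmd).
have tn : (t + m + 2 <= n)%N.
  rewrite -(ler_nat R) -addnA natrD.
  rewrite mulrBl mul1r in t2; lra.
have t2n : (1 < t <= n)%N.
  by rewrite (leq_trans _ mt) ?addn2 //= (leq_trans _ tn) // -addnA leq_addr.
have tn' : (t < n)%N by rewrite (leq_trans _ tn) // addn2 ltnS leqW ?leq_addr.
have G'P := fintype.subset_trans G'G GP.
have [|c [T [cinj hT G'S]]] := @hamiltonian_no_cycle_container n G' t m D G'P ham noc mt _ isT.
  by rewrite (leq_trans _ tn) ?leq_addr.
have [|f Tf] := @tuple_of_small_set _ (K ^ 2 * n) T.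
  by apply: fingerprint_size_le hT; rewrite // ltnW.
exists ((c, Ordinal tn'), f); rewrite /bad /S /= -Tf; split.
  have h1 := card_chord_container t m D T cinj.
  have h2 : (K * (2 * (2 * #|chord_container c t m D T|)) <= (K + 5) * n ^ 2)%N.
    apply: leq_trans (@card_shift_container_le n t K T K2 nK t2n).
    by rewrite leq_mul2l leq_mul2l h1 !orbT.
  have {h2} : (K * (2 * (2 * #|chord_container c t m D T|)))%:R <= ((K + 5) * n ^ 2)%:R :> R.
    by rewrite ler_nat.
  rewrite -mulnn !natrM natrD -expr2 => h2; rewrite -(ler_pM2l K0).
  have := ler_wpM2r (exprn_ge0 2 (ltW n0)) epsK.
  lra.
(* The edges of [G'] lie in [G :&: S j], so the bad event concerns [G] alone. *)
apply: lt_le_trans big _; rewrite ler_nat; apply: subset_leq_card.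
by rewrite subsetI G'G.
Qed.

Lemma ln_natr_le_sqrt (R : realType) (n : nat) : (0 < n)%N ->
  ln (n%:R : R) <= 2 * Num.sqrt n%:R.
Proof.
move=> n0; have s0 : 0 < Num.sqrt (n%:R : R) by rewrite sqrtr_gt0 ltr0n.
rewrite -{1}(@sqr_sqrtr _ (n%:R : R)) ?ler0n // lnXn // mulr_natl.
by rewrite lerMn2r ltW // ln_sublinear.
Qed.

Lemma natr_exp_expR (R : realType) (n k : nat) : (0 < n)%N ->
  (n ^ k)%:R = expR (k%:R * ln n%:R) :> R.
Proof. by move=> n0; rewrite expRM_natl lnK ?natrX // posrE ltr0n. Qed.

(** The hypothesis gives [c n^2 p >= (2 L + 1) n^(3/2)], while [L n ln n <= 2 L n^(3/2)]. The
    surplus [n^(3/2) >= n] leaves [expR (- n)], at most [1 / (n + 1)]. *)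
Lemma union_bound_small (R : realType) (n L : nat) (c p : R) :
  (0 < n)%N -> 0 < c -> ((2 * L%:R + 1) / c) / Num.sqrt n%:R <= p ->
  (n ^ (L * n))%:R * expR (- (c * (n%:R ^+ 2 * p))) <= n.+1%:R^-1.
Proof.
move=> n0 c0 hp; set s := Num.sqrt n%:R in hp.
have n0R : 0 < n%:R :> R by rewrite ltr0n.
have s0 : 0 < s by rewrite sqrtr_gt0.
have s1 : 1 <= s by rewrite -sqrtr1 ler_wsqrtr // ler1n.
have sn : n%:R = s ^+ 2 by rewrite sqr_sqrtr // ltW.
have hln : ln n%:R <= 2 * s by exact: ln_natr_le_sqrt.
have hcp : (2 * L%:R + 1) * (n%:R * s) <= c * (n%:R ^+ 2 * p).
  have : (2 * L%:R + 1) <= p * s * c by rewrite -ler_pdivrMr // -ler_pdivrMr.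
  have : 0 <= n%:R * s by rewrite mulr_ge0 // ltW.
  move=> ns h; have := ler_wpM2r ns h; congr (_ <= _).
  by rewrite sn; ring.
rewrite natr_exp_expR // -expRD.
apply: (@le_trans _ _ (expR (- n%:R))).
  rewrite ler_expR natrM -mulrA.
  have h1 : L%:R * (n%:R * ln n%:R) <= L%:R * (n%:R * (2 * s)).
    by rewrite !ler_wpM2l // ltW.
  have h2 : n%:R <= n%:R * s by rewrite ler_peMr // ltW.
  move: hcp; rewrite mulrDl mul1r; lra.
rewrite expRN lef_pV2 ?posrE ?ltr0n ?expR_gt0 //.
by apply: le_trans (expR_ge1Dx _); rewrite -natr1 addrC.
Qed.

Local Open Scope classical_set_scope.

Theorem theorem3p7 (R : realType) (eps delta : R) :
  0 < eps -> 0 < delta ->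
  exists C : R, 0 < C /\
    forall p : nat -> R,
      (forall n : nat, 0 <= p n <= 1) ->
      (\forall n \near \oo, C / Num.sqrt (n%:R : R) <= p n) ->
      aas p (fun (n : nat) (G : {set {set 'I_n}}) =>
        forall G' : {set {set 'I_n}},
          G' \subset G ->
          hamiltonian G' ->
          (2^-1 + eps) * ((n%:R) ^+ 2 * p n / 2) < (#|G'|)%:R ->
          forall t : nat,
            delta * n%:R <= t%:R <= (1 - delta) * n%:R ->
            has_cycle G' t).
Proof.
move=> e0 d0.
(* The bound [5 / eps] brings the container density down to the required one; [2 / delta] lets all
   shifts fit for every [t] in the range. *)
pose K := (2 + Num.bound (5 / eps) + Num.bound (2 / delta))%N.
have K2 : (1 < K)%N by rewrite /K; lia.
have bound_ge (x : R) : 0 < x -> x <= (Num.bound x)%:R.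
  by move=> x0; apply/ltW/archi_boundP/ltW.
have epsK : 5 <= eps * K%:R.
  rewrite mulrC -ler_pdivrMr // (le_trans (bound_ge _ _)) ?divr_gt0 //.
  by rewrite ler_nat /K addnAC leq_addl.
have deltaK : 2 <= delta * K%:R.
  rewrite mulrC -ler_pdivrMr // (le_trans (bound_ge _ _)) ?divr_gt0 //.
  by rewrite ler_nat /K leq_addl.
pose c := eps ^+ 2 / (8 * (2 + 3 * eps)).
have c0 : 0 < c by rewrite divr_gt0 ?exprn_gt0 // mulr_gt0 //; lra.
pose L := (3 * K ^ 2 + 2)%N.
exists ((2 * L%:R + 1) / c); split; first by rewrite divr_gt0 // ltr_wpDl ?mulr_ge0.
move=> p hp hC.
apply: (@squeeze_cvgr _ _ _ _ (fun n => 1 - n.+1%:R^-1) (fun _ => 1)); last exact: cvg_cst.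
  near=> n; rewrite gnp_pr_le1 // andbT.
  have nK : (2 * K ^ 2 <= n)%N by near: n; exact: nbhs_infty_ge.
  have n0 : (0 < n)%N by rewrite (leq_trans _ nK) // muln_gt0 expn_gt0; lia.
  apply: le_trans (gnp_cycles_ge (hp n) e0 K2 nK epsK deltaK).
  rewrite lerD2l lerN2; apply: union_bound_small => //.
  by near: n; exact: hC.
rewrite -[X in _ --> X]subr0; apply: cvgB; first exact: cvg_cst.
exact: cvg_harmonic.
Unshelve. all: by end_near.
Qed.
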